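(* Let $G$ be a non-trivial connected graph on $n$ vertices, with $e(G)$ edges and diameter $\mathrm{diam}(G)$. (a) $\mathrm{diam}(G)\le rc(G)\le rc^\ell(G)\le n-1$, and $\mathrm{diam}(G)\le rc(G)\le src(G)\le src^\ell(G)\le e(G)$. (b) If $G$ has $p$ bridges, then $rc(G)\ge p$. (c) If $v$ is a cut-vertex of $G$ such that $G-v$ has $q\ge 2$ components, then $src(G)\ge q$. (d) If $n\ge 3$ and $w$ is a pendent vertex (vertex of degree $1$) of $G$, then $rc(G)\ge rc(G-w)$ and $src(G)\ge src(G-w)$. (e) The following are equivalent: (i) $G$ is a complete graph; (ii) $\mathrm{diam}(G)=1$; (iii) $rc(G)=1$; (iv) $src(G)=1$; (v) $rc^\ell(G)=1$; (vi) $src^\ell(G)=1$. (f) $rc(G)=2$ if and only if $src(G)=2$. Moreover, $src^\ell(G)=2$ implies $rc^\ell(G)=2$, which in turn implies both $rc(G)=2$ and $src(G)=2$. (g) The following are equivalent: (i) $G$ is a tree; (ii) $rc(G)=e(G)$; (iii) $src(G)=e(G)$; (iv) $rc^\ell(G)=e(G)$; (v) $src^\ell(G)=e(G)$.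
   Context: All graphs are finite, simple and undirected. An edge-colouring of a graph need not be proper. An edge-coloured path is rainbow if all its edges have distinct colours. A geodesic between two vertices is a path between them of shortest possible length. An edge-colouring of a connected graph $G$ is rainbow connected (resp. strongly rainbow connected) if any two vertices are joined by a rainbow path (resp. a rainbow geodesic). $rc(G)$ (resp. $src(G)$) is the minimum number of colours in a rainbow connected (resp. strongly rainbow connected) edge-colouring of $G$. An $r$-edge-list assignment of $G$ is a function $L$ assigning to each edge $e$ a set $L(e)\subset\mathbb N$ with $|L(e)|\ge r$; an $L$-edge-colouring is an edge-colouring $c$ with $c(e)\in L(e)$ for all edges $e$. The list rainbow connection number $rc^\ell(G)$ (resp. list strong rainbow connection number $src^\ell(G)$) is the minimum integer $r$ such that for every $r$-edge-list assignment $L$ of $G$ there is an $L$-edge-colouring of $G$ that is rainbow connected (resp. strongly rainbow connected). *)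

(* Defs.v *)
From mathcomp Require Import all_boot.
From mathcomp Require Import boolp classical_sets functions cardinality.

Set Implicit Arguments.
Unset Strict Implicit.
Unset Printing Implicit Defensive.

(* The value is 0 if no natural number satisfies P; the minima below that are
   taken over a connected graph are all attained. *)
Definition nat_min (P : nat -> Prop) : nat :=
  if pselect (exists n, `[<P n>]) is left exP then ex_minn exP else 0.

Lemma nat_minP (P : nat -> Prop) : (exists n, P n) ->
  P (nat_min P) /\ (forall m, P m -> nat_min P <= m).
Proof.
move=> [n Pn]; rewrite /nat_min; case: pselect => [exP | []]; last first.
  by exists n; apply/asboolP.
case: ex_minnP => m /asboolP Pm min_m; split=> // k Pk.
by apply: min_m; apply/asboolP.
Qed.

Record sgraph := SGraph {
  vertex :> finType;
  adj : rel vertex;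
  adj_sym : symmetric adj;
  adj_irrefl : irreflexive adj
}.

Definition edges (G : sgraph) : {set {set G}} :=
  [set [set p.1; p.2] | p : G * G & adj p.1 p.2].

Definition connected (G : sgraph) : Prop :=
  forall x y : G, connect (@adj G) x y.

Definition components (G : sgraph) : nat := n_comp (@adj G) predT.

Definition complete (G : sgraph) : Prop :=
  forall x y : G, x != y -> adj x y.

Definition tree (G : sgraph) : Prop :=
  connected G /\
  (forall s : seq G, 2 < size s -> ~ ucycle (@adj G) s).

Definition degree (G : sgraph) (v : G) : nat := #|[set u | adj v u]|.

Definition pendent (G : sgraph) (v : G) : Prop := degree v = 1.

Lemma del_vertex_sym (G : sgraph) (v : G) :
  symmetric (fun x y : {u : G | u != v} => adj (val x) (val y)).
Proof. by move=> x y; rewrite adj_sym. Qed.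

Lemma del_vertex_irrefl (G : sgraph) (v : G) :
  irreflexive (fun x y : {u : G | u != v} => adj (val x) (val y)).
Proof. by move=> x; rewrite adj_irrefl. Qed.

Definition del_vertex (G : sgraph) (v : G) : sgraph :=
  SGraph (@del_vertex_sym G v) (@del_vertex_irrefl G v).

Lemma del_edge_sym (G : sgraph) (e : {set G}) :
  symmetric (fun x y : G => adj x y && ([set x; y] != e)).
Proof. by move=> x y; rewrite adj_sym finset.setUC. Qed.

Lemma del_edge_irrefl (G : sgraph) (e : {set G}) :
  irreflexive (fun x y : G => adj x y && ([set x; y] != e)).
Proof. by move=> x; rewrite adj_irrefl. Qed.

Definition del_edge (G : sgraph) (e : {set G}) : sgraph :=
  SGraph (@del_edge_sym G e) (@del_edge_irrefl G e).

Definition bridges (G : sgraph) : {set {set G}} :=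
  [set e in edges G | components G < components (del_edge e)].

Definition cut_vertex (G : sgraph) (v : G) : Prop :=
  components G < components (del_vertex v).

(* The path with vertex sequence x :: p; its length is size p. *)
Definition is_path (G : sgraph) (x y : G) (p : seq G) : Prop :=
  [/\ path (@adj G) x p, last x p = y & uniq (x :: p)].

Definition geodesic (G : sgraph) (x y : G) (p : seq G) : Prop :=
  is_path x y p /\ (forall q : seq G, is_path x y q -> size p <= size q).

Definition dist (G : sgraph) (x y : G) : nat :=
  nat_min (fun k => exists2 p : seq G, is_path x y p & size p = k).

Definition diam (G : sgraph) : nat := \max_(x : G) \max_(y : G) dist x y.

(* Values outside [edges G] are never used. *)
Definition colouring (G : sgraph) : Type := {set G} -> nat.

Definition num_colours (G : sgraph) (c : colouring G) : nat :=
  size (undup [seq c e | e in edges G]).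

Definition rainbow (G : sgraph) (c : colouring G) (x : G) (p : seq G) : Prop :=
  uniq (pairmap (fun u v => c [set u; v]) x p).

Definition rainbow_connected (G : sgraph) (c : colouring G) : Prop :=
  forall x y : G, exists2 p : seq G, is_path x y p & rainbow c x p.

Definition strongly_rainbow_connected (G : sgraph) (c : colouring G) : Prop :=
  forall x y : G, exists2 p : seq G, geodesic x y p & rainbow c x p.

Definition rc (G : sgraph) : nat :=
  nat_min (fun k => exists2 c : colouring G,
    rainbow_connected c & num_colours c = k).

Definition src (G : sgraph) : nat :=
  nat_min (fun k => exists2 c : colouring G,
    strongly_rainbow_connected c & num_colours c = k).

Definition edge_list_assignment (G : sgraph) (r : nat)
    (L : {set G} -> set nat) : Prop :=
  forall e, e \in edges G -> (`I_r #<= L e)%card.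

Definition list_colouring (G : sgraph) (L : {set G} -> set nat)
    (c : colouring G) : Prop :=
  forall e, e \in edges G -> L e (c e).

Definition rcl (G : sgraph) : nat :=
  nat_min (fun r => forall L : {set G} -> set nat, edge_list_assignment r L ->
    exists2 c : colouring G, list_colouring L c & rainbow_connected c).

Definition srcl (G : sgraph) : nat :=
  nat_min (fun r => forall L : {set G} -> set nat, edge_list_assignment r L ->
    exists2 c : colouring G,
      list_colouring L c & strongly_rainbow_connected c).

(* Main.v *)
Require Import Defs.
From mathcomp Require Import boolp classical_sets cardinality.
From mathcomp Require Import all_boot zify.

Set Implicit Arguments.
Unset Strict Implicit.
Unset Printing Implicit Defensive.

(** The chains of inequalities come from two facts: a rainbow path is at most
    as long as the number of colours, and [r] edges with lists of size [r] can
    be coloured injectively by a greedy choice.  Applied to a spanning tree the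
    latter bounds [rcl] by [n - 1], applied to all edges it bounds [srcl] by
    [e(G)].  For (b), any two bridges separate a common pair of vertices, so
    their colours differ.

    The substantial part of (g) is that [srcl] drops below [e(G)] as soon as
    some edge [ab] is not a bridge.  Two edges of a geodesic are positioned so
    that both ends of the second are strictly closer to the same end of the
    first.  A path from [a] to [b] avoiding [ab] leaves the set of vertices
    closer to [a] than to [b] through some edge [cd]; hence no geodesic contains
    both [ab] and [cd], and these two edges may share a colour. *)

Lemma nat_min_in (P : nat -> Prop) : (exists n, P n) -> P (nat_min P).
Proof. by case/nat_minP. Qed.

Lemma nat_min_le (P : nat -> Prop) (n : nat) : P n -> nat_min P <= n.
Proof. by move=> Pn; have [|_] := @nat_minP P; [exists n | apply]. Qed.

Lemma set2_eq (T : finType) (a b u v : T) :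
  [set a; b] = [set u; v] -> (a = u /\ b = v) \/ (a = v /\ b = u).
Proof.
move=> E; have := set21 a b; have := set22 a b; rewrite E !inE.
have := set21 u v; have := set22 u v; rewrite -E !inE.
by case/orP=> /eqP-> /orP[]/eqP-> /orP[]/eqP ? /orP[]/eqP ?; auto.
Qed.

Lemma last_take (T : Type) (x : T) (s : seq T) (n : nat) :
  n <= size s -> last x (take n s) = nth x (x :: s) n.
Proof.
move=> le_n; rewrite (last_nth x) size_takel //.
by rewrite -(nth_take x (ltnSn n) (x :: s)).
Qed.

Lemma uniq_map_inj_in (T U : eqType) (f : T -> U) (s : seq T) :
  uniq [seq f x | x <- s] -> {in s &, injective f}.
Proof.
elim: s => //= x s IHs /andP[nfx /IHs f_inj] y z; rewrite !inE.
case/predU1P=> [->|ys]; case/predU1P=> [->//|zs] fE.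
- by case/negP: nfx; rewrite fE map_f.
- by case/negP: nfx; rewrite -fE map_f.
exact: f_inj.
Qed.

Lemma count_enum_lt (T : finType) (A B : {set T}) (P : pred T) (x : T) :
  {in A, forall y, P y -> y \in B} -> x \in B -> ~~ P x ->
  count P (enum A) < #|B|.
Proof.
move=> PB xB nPx; rewrite (cardsD1 x) xB ltnS -size_filter cardE.
apply: uniq_leq_size => [|y]; first exact/filter_uniq/enum_uniq.
rewrite mem_filter !mem_enum !inE => /andP[Py Ay].
by rewrite PB // andbT; apply: contraNneq nPx => <-.
Qed.

Lemma connect_exit (T : finType) (e : rel T) (P : pred T) (x y : T) :
  connect e x y -> P x -> ~~ P y -> exists u v, [/\ e u v, P u & ~~ P v].
Proof.
case/connectP=> p pth -> {y}; elim: p x pth => [|y p IHp] x /=.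
  by move=> _ ->.
case/andP=> exy pyp Px; case: (boolP (P y)) => [Py|nPy _]; first exact: IHp.
by exists x, y.
Qed.

(** * Greedy choice from lists *)

Lemma card_le_avoid (T : eqType) (r : nat) (A : set T) (s : seq T) :
  (`I_r #<= A)%card -> size s < r -> exists2 k, A k & k \notin s.
Proof.
move=> r_le_A; rewrite ltnNge => /negP lt_s_r; apply: contrapT => A_sub_s.
apply: lt_s_r; rewrite -card_le_II; apply: (card_le_trans r_le_A).
apply: card_le_trans (card_ge_preimage (f := index^~ s) _).
  apply: subset_card_le => k Ak /=; rewrite index_mem.
  by apply/negPn/negP=> nks; apply: A_sub_s; exists k.
by move=> k l /set_mem + /set_mem; rewrite /= !index_mem; apply: index_inj.
Qed.

(* Reading [s] from its end, each new element conflicts with fewer than [r]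
   earlier ones: [s] reversed is an [r.-1]-degenerate ordering. *)
Fixpoint degenerate (T : Type) (R : rel T) (r : nat) (s : seq T) : bool :=
  if s is x :: s' then (count (R x) s' < r) && degenerate R r s' else true.

Lemma degenerate_bounded_degree (T : eqType) (R : rel T) (r : nat) (s : seq T) :
  {in s, forall x, count (R x) s < r} -> degenerate R r s.
Proof.
elim: s => //= x s IHs deg_s; apply/andP; split.
  exact: leq_ltn_trans (leq_addl _ _) (deg_s x (mem_head x s)).
apply: IHs => y ys; apply: leq_ltn_trans (leq_addl _ _) (deg_s y _).
by rewrite inE ys orbT.
Qed.

Lemma degenerate_choice (T : eqType) (U : pointedType) (R : rel T) (r : nat)
    (s : seq T) (L : T -> set U) :
  symmetric R -> irreflexive R -> degenerate R r s ->
  {in s, forall x, (`I_r #<= L x)%card} ->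
  exists2 c : T -> U, {in s, forall x, L x (c x)} &
    {in s &, forall x y, R x y -> c x != c y}.
Proof.
move=> Rsym Rirr; elim: s => [|x s IHs] /=; first by exists (fun=> point).
case/andP=> deg_x /IHs{}IHs rL.
have [|c cL cR] := IHs; first by move=> y ys; apply: rL; rewrite inE ys orbT.
have [||k Lk nk] := @card_le_avoid _ r (L x) [seq c y | y <- s & R x y].
- exact/rL/mem_head.
- by rewrite size_map size_filter.
have k_neq y : y \in s -> R x y -> k != c y.
  by move=> ys Rxy; apply: contraNneq nk => ->; rewrite map_f // mem_filter Rxy.
exists (fun y => if y == x then k else c y) => [y|y z]; rewrite !inE.
  by case: eqP => [->|_] //= /cL.
case: eqP => [->|_]; case: eqP => [->|_] //=; first by rewrite Rirr.
- by move=> _; apply: k_neq.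
- by move=> ys _; rewrite Rsym eq_sym; apply: k_neq.
- exact: cR.
Qed.

(** * Components *)

Lemma adj_connect_sym (G : sgraph) : connect_sym (@adj G).
Proof. exact/sym_connect_sym/adj_sym. Qed.

Lemma components_le1P (G : sgraph) : components G <= 1 <-> connected G.
Proof.
have rootP := rootP (@adj_connect_sym G).
have roots_root := roots_root (@adj_connect_sym G).
split=> [/card_le1_eqP le1 x y|connG].
  by apply/rootP/le1; rewrite !inE roots_root.
apply/card_le1_eqP=> x y; rewrite !inE !andbT => /eqP<- /eqP<-.
exact/rootP.
Qed.

Lemma components_gt0 (G : sgraph) (x : G) : 0 < components G.
Proof.
apply/card_gt0P; exists (root (@adj G) x).
by rewrite !inE (roots_root (@adj_connect_sym G)).
Qed.

(** * Edges and paths *)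

Section Graph.

Variable G : sgraph.
Implicit Types (a b u v w x y z : G) (p q : seq G) (e f : {set G}).
Implicit Types (T : {set {set G}}) (c : colouring G) (L : {set G} -> set nat).

Lemma edgesP e :
  reflect (exists u v, adj u v /\ e = [set u; v]) (e \in edges G).
Proof.
apply: (iffP imsetP) => [[[u v] /= ] | [u [v [auv ->]]]].
  by rewrite inE => auv ->; exists u, v.
by exists (u, v); rewrite ?inE.
Qed.

Lemma adj_edge u v : adj u v -> [set u; v] \in edges G.
Proof. by move=> auv; apply/edgesP; exists u, v. Qed.

Lemma adj_neq u v : adj u v -> u != v.
Proof. by apply: contraTneq => ->; rewrite adj_irrefl. Qed.

Definition path_edges x p : seq {set G} :=
  pairmap (fun u v => [set u; v]) x p.

Lemma path_edges_sub x p :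
  path (@adj G) x p -> {subset path_edges x p <= edges G}.
Proof.
elim: p x => //= y p IHp x /andP[axy /IHp pE] e; rewrite inE.
by case/orP=> [/eqP->|/pE//]; apply: adj_edge.
Qed.

Lemma path_edges_vertex x z p e :
  e \in path_edges x p -> z \in e -> z \in x :: p.
Proof.
elim: p x => //= y p IHp x; rewrite in_cons => /orP[/eqP->|ep ze].
  by rewrite !inE => /orP[]->; rewrite ?orbT.
by rewrite inE IHp ?orbT.
Qed.

Lemma uniq_path_edges x p : uniq (x :: p) -> uniq (path_edges x p).
Proof.
elim: p x => //= y p IHp x /andP[nx Uyp]; rewrite IHp // andbT.
by apply: contra nx => /path_edges_vertex; apply; apply: set21.
Qed.

Lemma path_edges_nth x p e :
  e \in path_edges x p ->
  exists2 i, i < size p & e = [set nth x (x :: p) i; nth x (x :: p) i.+1].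
Proof.
case/(nthP set0)=> i; rewrite size_pairmap => lt_i <-.
by exists i => //; rewrite (nth_pairmap x).
Qed.

Lemma is_path_shorten x p :
  path (@adj G) x p -> exists2 q, is_path x (last x p) q & size q <= size p.
Proof.
case/shortenP=> q pq Uq sub; exists q => //.
by apply: uniq_leq_size => //; case/andP: Uq.
Qed.

Lemma is_path_connect x y p : is_path x y p -> connect (@adj G) x y.
Proof. by case=> pp <- _; apply/connectP; exists p. Qed.

Lemma is_path_rev x y p : is_path x y p -> is_path y x (rev (belast x p)).
Proof.
case=> pp <- Up; split.
- by rewrite rev_path (eq_path (e' := @adj G)) // => u v; rewrite adj_sym.
- by case: p {pp Up} => //= y' p; rewrite rev_cons last_rcons.
- by rewrite -rev_rcons -lastI rev_uniq.
Qed.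

Definition adj_via (Q : pred {set G}) : rel G :=
  [rel u v | adj u v && Q [set u; v]].

Lemma adj_via_sym Q : symmetric (adj_via Q).
Proof. by move=> u v; rewrite /adj_via /= adj_sym setUC. Qed.

Lemma path_adj_via Q x p :
  path (adj_via Q) x p = path (@adj G) x p && all Q (path_edges x p).
Proof. by elim: p x => //= y p IHp x; rewrite IHp andbACA. Qed.

Lemma connect_adj_viaP Q x y :
  reflect (exists2 p, is_path x y p & all Q (path_edges x p))
          (connect (adj_via Q) x y).
Proof.
apply: (iffP connectP) => [[p /shortenP[q + Uq _] ->]|[p [pp lp _] pQ]].
  by rewrite path_adj_via => /andP[pq qQ]; exists q.
by exists p; rewrite // path_adj_via pp.
Qed.

(** * Distances and geodesics *)

Lemma dist_le_path x p : path (@adj G) x p -> dist x (last x p) <= size p.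
Proof.
move=> /is_path_shorten[q qP]; apply: leq_trans.
by apply: nat_min_le; exists q.
Qed.

Lemma dist_attained x y : connect (@adj G) x y ->
  exists2 p, is_path x y p & size p = dist x y.
Proof.
case/connectP=> p /is_path_shorten[q qP _] yE; rewrite -yE in qP.
apply: (@nat_min_in (fun k => exists2 p, is_path x y p & size p = k)).
by exists (size q), q.
Qed.

Lemma geodesic_exists x y : connect (@adj G) x y -> exists p, geodesic x y p.
Proof.
case/dist_attained=> p pP pd; exists p; split=> // q [pq lq _].
by rewrite pd -lq dist_le_path.
Qed.

Lemma size_geodesic x y p : geodesic x y p -> size p = dist x y.
Proof.
move=> [pP pmin]; have [q qP qd] := dist_attained (is_path_connect pP).
apply/eqP; rewrite eqn_leq -{1}qd pmin //=.
by case: pP => pp <- _; apply: dist_le_path.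
Qed.

Lemma dist_xx x : dist x x = 0.
Proof. by apply/eqP; rewrite -leqn0 (@dist_le_path x [::]). Qed.

Lemma adj_dist_le1 x y : adj x y -> dist x y <= 1.
Proof. by move=> axy; apply: (@dist_le_path x [:: y]); rewrite /= axy. Qed.

Lemma dist_sym x y : dist x y = dist y x.
Proof.
congr nat_min; apply/funext=> k; apply/propext.
by split=> -[p /is_path_rev pP <-];
  [exists (rev (belast x p)) | exists (rev (belast y p))];
  rewrite // size_rev size_belast.
Qed.

Lemma dist_triangle y x z : connect (@adj G) x y -> connect (@adj G) y z ->
  dist x z <= dist x y + dist y z.
Proof.
move=> /geodesic_exists[p gp] /geodesic_exists[q gq].
rewrite -(size_geodesic gp) -(size_geodesic gq) -size_cat.
case: gp gq => -[pp lp _] _ [[pq <- _] _].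
by rewrite -{1}lp -last_cat dist_le_path // cat_path pp lp.
Qed.

Lemma dist_eq0 x y : connect (@adj G) x y -> (dist x y == 0) = (x == y).
Proof.
move=> cxy; apply/idP/eqP=> [|->]; last by rewrite dist_xx.
have [p gp] := geodesic_exists cxy; rewrite -(size_geodesic gp).
by case: gp => -[_ <- _] _ /nilP->.
Qed.

Lemma dist_le1_adj x y : connect (@adj G) x y -> dist x y <= 1 ->
  x != y -> adj x y.
Proof.
move=> /geodesic_exists[p gp]; rewrite -(size_geodesic gp).
case: gp => -[]; case: p => [_ /= ->|z [|//]]; first by rewrite eqxx.
by rewrite /= andbT => + <-.
Qed.

Lemma dist_path_nth_le x p i j : path (@adj G) x p -> i <= j <= size p ->
  dist (nth x (x :: p) i) (nth x (x :: p) j) <= j - i.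
Proof.
move=> pp /andP[le_ij le_j].
have le_i := leq_trans le_ij le_j.
rewrite -!last_take // -(subnKC le_ij) takeD last_cat subnKC //.
move: pp; rewrite -{1}(cat_take_drop i p) cat_path => /andP[_ pd].
apply: leq_trans (dist_le_path _) _; last by rewrite size_take_min geq_minl.
exact: take_path.
Qed.

Lemma dist_geodesic_nth x y p i j :
  geodesic x y p -> i <= j <= size p ->
  dist (nth x (x :: p) i) (nth x (x :: p) j) = j - i.
Proof.
move=> gp /andP[le_ij le_j]; set s := nth x (x :: p).
have [[pp lp _] _] := gp.
have conn k l : k <= size p -> l <= size p -> connect (@adj G) (s k) (s l).
  have conn0 m : m <= size p -> connect (@adj G) x (s m).
    by move=> le_m; apply: (path_connect pp); apply: mem_nth.
  by move=> /conn0 xk /conn0; apply: connect_trans; rewrite adj_connect_sym.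
have le_dist k l := @dist_path_nth_le x p k l pp.
apply/eqP; rewrite eqn_leq le_dist ?le_ij //=.
have sy : s (size p) = y by rewrite /s -last_nth.
have := size_geodesic gp; rewrite -[in dist _ _]sy -[x in dist x]/(s 0).
have := le_dist 0 i; have := le_dist j (size p); rewrite -/s.
have := dist_triangle (conn 0 i _ _) (conn i (size p) _ _).
have := dist_triangle (conn i j _ _) (conn j (size p) _ _).
lia.
Qed.

Lemma geodesic_edges_same_side x y a b (c d : G) p :
  geodesic x y p -> [set a; b] \in path_edges x p ->
  [set c; d] \in path_edges x p -> [set a; b] != [set c; d] ->
  dist a c < dist b c -> dist a d < dist b d.
Proof.
move=> gp /path_edges_nth[i lt_i abE] /path_edges_nth[j lt_j cdE] neq.
have {neq} ij : i != j by apply: contraNneq neq => ij; rewrite abE cdE ij.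
set s := nth x (x :: p) in abE cdE.
have dE k l : k <= size p -> l <= size p ->
    dist (s k) (s l) = (k - l) + (l - k).
  move=> le_k le_l; have [le_kl|lt_lk] := leqP k l.
    by rewrite (dist_geodesic_nth gp) ?le_kl //; lia.
  by rewrite dist_sym (dist_geodesic_nth gp) ?(ltnW lt_lk) //; lia.
by case: (set2_eq abE) => -[-> ->]; case: (set2_eq cdE) => -[-> ->];
  rewrite !dE //; lia.
Qed.

Lemma diam_leP k : reflect (forall x y, dist x y <= k) (diam G <= k).
Proof.
apply: (iffP (bigmax_leqP _ _ _)) => [le_k x y|le_k x _].
  by have /bigmax_leqP := le_k x isT; apply.
by apply/bigmax_leqP.
Qed.

Lemma diam_le1_complete : connected G -> diam G <= 1 <-> complete G.
Proof.
move=> connG; split=> [/diam_leP le1 x y|complG].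
  exact: dist_le1_adj.
apply/diam_leP=> x y; have [->|/complG/adj_dist_le1//] := eqVneq x y.
by rewrite dist_xx.
Qed.

Lemma diam_gt0 : connected G -> 1 < #|G| -> 0 < diam G.
Proof.
move=> connG /card_gt1P[x [y [_ _ neq]]]; rewrite ltnNge.
by apply: contra neq => /diam_leP/(_ x y); rewrite leqn0 dist_eq0.
Qed.

(** * Bridges and components *)

(* [adj_via (predC1 e)] is convertible to the adjacency of [del_edge e]. *)
Definition separates e x y : bool := ~~ connect (adj_via (predC1 e)) x y.

Lemma separatesP e x y :
  reflect (forall p, is_path x y p -> e \in path_edges x p) (separates e x y).
Proof.
apply: (iffP idP) => [sep p pP|sep].
  apply: contraR sep => ne; apply/connect_adj_viaP; exists p => //.
  by apply/allP=> f fp /=; apply: contraNneq ne => <-.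
apply/connect_adj_viaP=> -[p /sep ep /allP/(_ _ ep)].
by rewrite /= eqxx.
Qed.

Lemma separates_sym e : symmetric (separates e).
Proof.
by move=> x y; rewrite /separates (sym_connect_sym (adj_via_sym _)).
Qed.

Lemma separates_transfer e y x z :
  separates e x z -> ~~ separates e y z -> separates e x y.
Proof.
rewrite /separates negbK => sep yz; apply: contra sep => xy.
exact: connect_trans xy yz.
Qed.

Lemma edge_not_separated e f u v :
  f \in edges G -> f != e -> u \in f -> v \in f -> ~~ separates e u v.
Proof.
case/edgesP=> a [b [aab ->]] neq; rewrite negbK.
have ab : connect (adj_via (predC1 e)) a b.
  by apply: connect1; rewrite /adj_via /= aab.
have ba := ab; rewrite (sym_connect_sym (adj_via_sym _)) in ba.
by rewrite !inE => /orP[]/eqP-> /orP[]/eqP->.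
Qed.

Lemma bridgeE a b : connected G -> adj a b ->
  ([set a; b] \in bridges G) = separates [set a; b] a b.
Proof.
move=> connG aab; rewrite inE adj_edge //=; set e := [set a; b].
apply/idP/idP=> [lt_comp|sep]; last first.
  apply: leq_ltn_trans (iffRL (components_le1P G) connG) _; rewrite ltnNge.
  by apply/negP=> /components_le1P/(_ a b); apply/negP.
apply: contraL lt_comp => ab; rewrite -leqNgt.
apply: leq_trans (components_gt0 a); apply/components_le1P => x y.
move: (connG x y); apply: connect_sub => u v auv.
have [/set2_eq[]|neq] := eqVneq [set u; v] e.
- by case=> -> ->.
- by case=> -> ->; rewrite (@adj_connect_sym (del_edge e)).
by apply: connect1; rewrite /= auv.
Qed.

Lemma bridge_separates_end e x : connected G -> e \in bridges G ->
  exists2 u, u \in e & separates e u x.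
Proof.
move=> connG eB.
have /edgesP[a [b [aab eE]]] : e \in edges G by case/setIdP: eB.
have sep : separates e a b by rewrite eE -bridgeE // -eE.
have [ax|nax] := boolP (separates e a x).
  by exists a; rewrite // eE set21.
exists b; first by rewrite eE set22.
rewrite separates_sym in sep; rewrite separates_sym in nax.
exact: separates_transfer sep nax.
Qed.

Lemma bridges_separate_common_pair e f : connected G ->
  e \in bridges G -> f \in bridges G -> e != f ->
  exists x y, separates e x y /\ separates f x y.
Proof.
move=> connG eB fB nef.
have eE : e \in edges G by case/setIdP: eB.
have fE : f \in edges G by case/setIdP: fB.
have edge_end g : g \in edges G -> exists u, u \in g.
  by case/edgesP=> u [v [_ ->]]; exists u; rewrite set21.
have [a ae] := edge_end e eE; have [d df] := edge_end f fE.
have [x xe sep_e] := bridge_separates_end d connG eB.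
have [y yf sep_f] := bridge_separates_end a connG fB.
exists x, y; split; last rewrite separates_sym.
  apply: separates_transfer sep_e (edge_not_separated fE _ yf df).
  by rewrite eq_sym.
exact: separates_transfer sep_f (edge_not_separated eE nef xe ae).
Qed.

Lemma tree_bridgesP : connected G -> tree G <-> edges G \subset bridges G.
Proof.
move=> connG; split=> [[_ acyc]|/subsetP EB].
  apply/subsetP=> e /edgesP[a [b [aab ->]]]; rewrite bridgeE //.
  apply/separatesP=> p [pp lp Up]; apply/negPn/negP=> nep.
  apply: (acyc (a :: p)); last first.
    by rewrite /ucycle Up andbT /= rcons_path pp lp adj_sym.
  case: p {pp Up} lp nep => [/= ab|z [/= ->|//]]; last by rewrite inE eqxx.
  by rewrite ab adj_irrefl in aab.
split=> [//|[|a [|b [|z s]]] // _ /andP[/= /and3P[aab abz ps] Us]].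
have := EB _ (adj_edge aab).
rewrite bridgeE // separates_sym => /separatesP sep.
have Uzs : uniq [:: b, z & rcons s a].
  by rewrite -!rcons_cons -rot1_cons rot_uniq.
have /sep : is_path b a (z :: rcons s a).
  by split=> //=; rewrite ?last_rcons // abz.
have [nb _] := andP Uzs; rewrite inE => /orP[/eqP/set2_eq|/path_edges_vertex].
  by case=> -[aE _]; case/andP: Us; rewrite aE !inE eqxx ?orbT.
by move/(_ _ (set22 a b)); apply/negP.
Qed.

(** * Rainbow paths *)

Lemma rainbowE c x p : rainbow c x p <-> uniq [seq c e | e <- path_edges x p].
Proof.
rewrite /rainbow; suff -> : pairmap (fun u v => c [set u; v]) x p =
  [seq c e | e <- path_edges x p] by [].
by elim: p x => //= y p IHp x; rewrite IHp.
Qed.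

Lemma rainbow_injP c x y p : is_path x y p ->
  rainbow c x p <-> {in path_edges x p &, injective c}.
Proof.
case=> _ _ Up; split=> [/rainbowE/uniq_map_inj_in //|c_inj].
by apply/rainbowE; rewrite map_inj_in_uniq ?uniq_path_edges.
Qed.

Lemma rainbow_size_le1 c x p : size p <= 1 -> rainbow c x p.
Proof. by case: p => [|y []]. Qed.

Lemma rainbow_size_le c x y p :
  is_path x y p -> rainbow c x p -> size p <= num_colours c.
Proof.
case=> pp _ _ /rainbowE Uc; rewrite -(size_pairmap (fun u v => [set u; v]) x).
rewrite -(size_map c); apply: uniq_leq_size => // k /mapP[e ep ->].
by rewrite mem_undup; apply/image_f/(path_edges_sub pp).
Qed.

Lemma num_colours_ge c (I : finType) (A : {pred I}) (g : I -> {set G}) :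
  {in A, forall i, g i \in edges G} -> {in A &, injective (c \o g)} ->
  #|A| <= num_colours c.
Proof.
move=> gE cI; rewrite -(size_image (c \o g) A); apply: uniq_leq_size.
  by rewrite map_inj_in_uniq ?enum_uniq // => i j; rewrite !mem_enum; apply: cI.
by move=> k /imageP[i /gE iE ->]; rewrite mem_undup; apply: image_f.
Qed.

Lemma num_colours_le c r :
  {in edges G, forall e, c e < r} -> num_colours c <= r.
Proof.
move=> cr; rewrite -(size_iota 0 r); apply: uniq_leq_size => [|k].
  exact: undup_uniq.
by rewrite mem_undup => /imageP[e /cr lt_e ->]; rewrite mem_iota.
Qed.

Lemma strongly_rainbow_connectedW c :
  strongly_rainbow_connected c -> rainbow_connected c.
Proof. by move=> src_c x y; have [p [pP _] rp] := src_c x y; exists p. Qed.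

Lemma strongly_rainbow_connected_inj c : connected G ->
  (forall x y p, geodesic x y p -> {in path_edges x p &, injective c}) ->
  strongly_rainbow_connected c.
Proof.
move=> connG cI x y; have [p gp] := geodesic_exists (connG x y).
by exists p => //; apply/(rainbow_injP c gp.1)/(cI _ _ _ gp).
Qed.

Lemma rainbow_connected_diam_le c :
  rainbow_connected c -> diam G <= num_colours c.
Proof.
move=> cP; apply/diam_leP=> x y; have [p pP rp] := cP x y.
apply: leq_trans (rainbow_size_le pP rp).
by case: pP => pp <- _; apply: dist_le_path.
Qed.

Lemma two_colours_strongly_rainbow_connected c :
  num_colours c <= 2 -> rainbow_connected c -> strongly_rainbow_connected c.
Proof.
move=> c2 cP x y; have [p pP rp] := cP x y.
have [q gq] := geodesic_exists (is_path_connect pP).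
have [q1|q2] := leqP (size q) 1.
  by exists q => //; apply: rainbow_size_le1.
exists p => //; split=> // s /gq.2; apply: leq_trans.
exact: leq_trans (leq_trans (rainbow_size_le pP rp) c2) q2.
Qed.

Lemma rainbow_connected_separators_neq c e f x y :
  rainbow_connected c -> separates e x y -> separates f x y -> e != f ->
  c e != c f.
Proof.
move=> cP /separatesP sep_e /separatesP sep_f; have [p pP] := cP x y.
move/(rainbow_injP c pP)=> c_inj; apply: contra_neq => /c_inj.
by apply; [apply: sep_e | apply: sep_f].
Qed.

Lemma rainbow_connected_bridges_le c : connected G -> rainbow_connected c ->
  #|bridges G| <= num_colours c.
Proof.
move=> connG cP; apply: (@num_colours_ge _ _ _ id) => [e /setIdP[]//|].
move=> e f eB fB /= cef; apply/eqP; apply: contra_eqT cef => nef.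
have [x [y [sep_e sep_f]]] := bridges_separate_common_pair connG eB fB nef.
exact: rainbow_connected_separators_neq sep_e sep_f nef.
Qed.

End Graph.

(** * Colour numbers of a property of colourings *)

(* [rc], [src] and [rcl], [srcl] are by conversion the colour and choice numbers
   of [rainbow_connected] and [strongly_rainbow_connected]. *)
Section ColourNumber.

Variables (G : sgraph) (P : colouring G -> Prop).
Implicit Types (c : colouring G) (L : {set G} -> set nat).

Definition colour_number : nat :=
  nat_min (fun k => exists2 c, P c & num_colours c = k).

Definition choosable (r : nat) : Prop :=
  forall L, edge_list_assignment r L -> exists2 c, list_colouring L c & P c.

Definition choice_number : nat := nat_min choosable.

Lemma colour_number_le c : P c -> colour_number <= num_colours c.
Proof. by move=> Pc; apply: nat_min_le; exists c. Qed.

Lemma colour_number_attained :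
  (exists c, P c) -> exists2 c, P c & num_colours c = colour_number.
Proof.
case=> c Pc; apply: (@nat_min_in (fun k => exists2 c, P c & num_colours c = k)).
by exists (num_colours c), c.
Qed.

Lemma choosable_num_colours r :
  choosable r -> exists2 c, P c & num_colours c <= r.
Proof.
case/(_ (fun=> `I_r)) => [e _|c cL Pc]; first exact: card_lexx.
by exists c => //; apply: num_colours_le => e /cL.
Qed.

Lemma choice_number_le r : choosable r -> choice_number <= r.
Proof. exact: nat_min_le. Qed.

Lemma choosable_choice_number r : choosable r -> choosable choice_number.
Proof. by move=> chr; apply: nat_min_in; exists r. Qed.

Lemma colour_number_le_choice_number r :
  choosable r -> colour_number <= choice_number.
Proof.
case/choosable_choice_number/choosable_num_colours=> c Pc.
by apply: leq_trans; apply: colour_number_le.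
Qed.

End ColourNumber.

Lemma choosableW (G : sgraph) (P Q : colouring G -> Prop) (r : nat) :
  (forall c, P c -> Q c) -> choosable P r -> choosable Q r.
Proof. by move=> PQ chP L /chP[c cL /PQ]; exists c. Qed.

Lemma colour_number_transfer (G H : sgraph) (P : colouring G -> Prop)
    (Q : colouring H -> Prop) (phi : colouring G -> colouring H) :
  (exists c, P c) -> (forall c, P c -> Q (phi c)) ->
  (forall c, num_colours (phi c) <= num_colours c) ->
  colour_number Q <= colour_number P.
Proof.
move=> /colour_number_attained[c Pc <-] PQ le_phi.
exact: leq_trans (colour_number_le (PQ c Pc)) (le_phi c).
Qed.

(** * Greedy list colourings *)

Section Choosability.

Variable G : sgraph.
Implicit Types (x y : G) (e : {set G}) (T : {set {set G}}).
Implicit Types (L : {set G} -> set nat).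

Lemma list_colouring_degenerate (R : rel {set G}) (r : nat)
    (s : seq {set G}) L :
  symmetric R -> irreflexive R -> edges G =i s -> degenerate R r s ->
  edge_list_assignment r L ->
  exists2 c, list_colouring L c &
    {in edges G &, forall e f, R e f -> c e != c f}.
Proof.
move=> Rsym Rirr sE deg_s rL.
have [|c cL cR] := degenerate_choice (U := nat) Rsym Rirr deg_s (L := L).
  by move=> e; rewrite -sE => /rL.
by exists c => [e|e f]; rewrite !sE; [apply: cL | apply: cR].
Qed.

Lemma choosable_injective T (r : nat) :
  T \subset edges G -> #|T| <= r -> (0 < #|edges G| -> 0 < r) ->
  choosable (fun c => {in T &, injective c}) r.
Proof.
move=> /subsetP TE leTr r_gt0 L rL.
pose R e f := [&& e != f, e \in T & f \in T].
have [||e||c cL cR] :=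
  @list_colouring_degenerate R r (enum (edges G)) L _ _ _ _ rL.
- by move=> e f; rewrite /R eq_sym [(e \in T) && _]andbC.
- by move=> e; rewrite /R eqxx.
- by rewrite mem_enum.
- apply: degenerate_bounded_degree => e; rewrite mem_enum => eE.
  have [eT|neT] := boolP (e \in T).
    apply: leq_trans leTr; apply: count_enum_lt eT _; last by rewrite /R eqxx.
    by move=> f _ /and3P[].
  have noR : R e =1 pred0 by move=> f; rewrite /R (negPf neT) andbF.
  by rewrite (eq_count noR) count_pred0; apply/r_gt0/card_gt0P; exists e.
exists c => // e f eT fT; apply: contra_eq => nef.
by apply: cR; rewrite ?TE // /R nef eT.
Qed.

Lemma strongly_rainbow_choosable_edges : connected G ->
  choosable (@strongly_rainbow_connected G) #|edges G|.
Proof.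
move=> connG; apply: choosableW (choosable_injective (subxx _) _ _) => // c cI.
apply: strongly_rainbow_connected_inj => // x y p [[pp _ _] _].
by move=> e f /(path_edges_sub pp) eE /(path_edges_sub pp); apply: cI.
Qed.

Lemma diam_le1_strongly_rainbow_choosable : connected G -> diam G <= 1 ->
  choosable (@strongly_rainbow_connected G) 1.
Proof.
move=> connG /diam_leP le1.
apply: choosableW (choosable_injective (T := set0) _ _ _);
  rewrite ?sub0set ?cards0 // => c _ x y.
have [p gp] := geodesic_exists (connG x y); exists p => //.
by apply: rainbow_size_le1; rewrite (size_geodesic gp).
Qed.

(** * Spanning trees *)

Lemma closer_neighbour x y : connect (@adj G) x y -> x != y ->
  exists2 z, adj x z & dist z y < dist x y.
Proof.
move=> /geodesic_exists[p gp]; rewrite -(size_geodesic gp).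
case: p gp => [|z p] [[pp lp _] _]; first by rewrite -lp eqxx.
move: pp lp => /= /andP[axz pp] <- _; exists z => //.
by rewrite ltnS dist_le_path.
Qed.

Lemma spanning_edges : connected G ->
  exists T, [/\ T \subset edges G, #|T| <= #|G| - 1 &
    forall x y, connect (adj_via [in T]) x y].
Proof.
move=> connG; case: (pickP G) => [r _|G0]; last first.
  by exists set0; split=> [||x]; rewrite ?sub0set ?cards0 //; have := G0 x.
have /fin_all_exists[f fP] x :
    exists y, x != r -> adj x y /\ dist y r < dist x r.
  have [->|xr] := eqVneq x r; first by exists r.
  by have [y axy lt_y] := closer_neighbour (connG x r) xr; exists y.
pose T := [set [set x; f x] | x in [set~ r]].
have to_r x : connect (adj_via [in T]) x r.
  have [n] := ubnP (dist x r); elim: n x => // n IHn x; rewrite ltnS => le_n.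
  have [->//|xr] := eqVneq x r; have [axf lt_f] := fP x xr.
  apply: connect_trans (IHn (f x) (leq_trans lt_f le_n)).
  by apply: connect1; rewrite /adj_via /= axf; apply: imset_f; rewrite !inE.
exists T; split=> [||x y].
- apply/subsetP=> e /imsetP[x]; rewrite !inE => /fP[axf _] ->.
  exact: adj_edge.
- by rewrite subn1 -(cardsC1 r) leq_imset_card.
apply: connect_trans (to_r x) _.
by rewrite (sym_connect_sym (adj_via_sym _)).
Qed.

Lemma edges_card_gt1 : 0 < #|edges G| -> 1 < #|G|.
Proof.
case/card_gt0P=> e /edgesP[u [v [auv _]]]; apply/card_gt1P; exists u, v.
by rewrite (adj_neq auv).
Qed.

Lemma rainbow_choosable_order : connected G ->
  choosable (@rainbow_connected G) (#|G| - 1).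
Proof.
move=> connG; have [T [TE leT spanT]] := spanning_edges connG.
apply: choosableW (choosable_injective TE leT _) => [c cI x y|].
  have /connect_adj_viaP[p pP /allP pT] := spanT x y.
  by exists p => //; apply/(rainbow_injP c pP)=> e f /pT eT /pT; apply: cI.
by rewrite subn_gt0; apply: edges_card_gt1.
Qed.

(** * Edges that are not bridges *)

Lemma nonbridge_incompatible_edge e :
  connected G -> e \in edges G -> e \notin bridges G ->
  exists f, [/\ f \in edges G, f != e &
    forall x y p, geodesic x y p ->
      e \in path_edges x p -> f \notin path_edges x p].
Proof.
move=> connG /edgesP[a [b [aab ->]]]; rewrite bridgeE // negbK => cab.
have [|| c [d [/andP[acd ne] closer_c ncloser_d]]] :=
    connect_exit (P := fun z => dist a z < dist b z) cab.
- by rewrite dist_xx lt0n dist_eq0 // eq_sym adj_neq.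
- by rewrite dist_xx ltn0.
exists [set c; d]; split=> // [|x y p gp ep]; first exact: adj_edge.
apply: contra ncloser_d => fp.
by apply: (geodesic_edges_same_side gp ep fp) closer_c; rewrite eq_sym.
Qed.

(* Colour greedily all edges but an edge [f] incompatible with [e]; the colour
   of [f] then only has to avoid those of the edges other than [e]. *)
Lemma nonbridge_strongly_rainbow_choosable e :
  connected G -> e \in edges G -> e \notin bridges G ->
  choosable (@strongly_rainbow_connected G) #|edges G|.-1.
Proof.
move=> connG eE neB L rL.
have [f [fE nfe sep]] := nonbridge_incompatible_edge connG eE neB.
set A := edges G :\ f; have eA : e \in A by rewrite !inE eq_sym nfe.
have cardA : #|edges G|.-1 = #|A| by rewrite (cardsD1 f) fE.
rewrite cardA in rL.
pose R g h := (g != h) && ([set g; h] != [set e; f]).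
have Rirr : irreflexive R by move=> g; rewrite /R eqxx.
have [|g||c cL cR] :=
  @list_colouring_degenerate R #|A| (f :: enum A) L _ Rirr _ _ rL.
- by move=> g h; rewrite /R eq_sym [[set h; g]]setUC.
- by rewrite !inE mem_enum !inE; case: eqVneq => // ->.
- rewrite /=; apply/andP; split.
    by apply: (count_enum_lt _ eA); rewrite // /R [[set f; e]]setUC eqxx andbF.
  apply: degenerate_bounded_degree => g; rewrite mem_enum => gA.
  by apply: (count_enum_lt _ gA); rewrite ?Rirr.
exists c => //; apply: strongly_rainbow_connected_inj => // x y p gp.
move=> g h g_p h_p; have [[pp _ _] _] := gp; apply: contra_eq => ngh.
apply: cR; rewrite ?(path_edges_sub pp) // /R ngh /=.
apply/eqP=> /set2_eq gh; have := sep _ _ _ gp.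
by case: gh g_p h_p => -[-> ->] g_p h_p; [move/(_ g_p) | move/(_ h_p)];
  rewrite ?g_p ?h_p.
Qed.

End Choosability.

(** * Deleting a vertex *)

Section DelVertex.

Variables (G : sgraph) (w : G).
Local Notation H := (del_vertex w).
Implicit Types (x y : H) (c : colouring G).

Lemma is_path_del_vertex x y q :
  is_path (val x) (val y) (map val q) <-> is_path x y q.
Proof.
rewrite /is_path path_map last_map -map_cons (map_inj_uniq val_inj).
by split=> -[pq lq Uq]; split=> //; [apply: val_inj | rewrite lq].
Qed.

Lemma is_path_lift x y p : is_path (val x) (val y) p -> w \notin p ->
  exists2 q, is_path x y q & p = map val q.
Proof.
move=> pP np; have [q pE] : exists q : seq H, p = map val q.
  elim: p np {pP} => [|z p IHp]; first by exists [::].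
  rewrite inE negb_or eq_sym => /andP[zw /IHp[q ->]].
  by exists (Sub z zw :: q).
by exists q => //; apply/is_path_del_vertex; rewrite -pE.
Qed.

Lemma del_vertex_neighbour x : connect (@adj G) (val x) w ->
  exists2 u : H, adj w (val u) & connect (@adj H) x u.
Proof.
pose P z := [exists u : H, (val u == z) && connect (@adj H) x u].
have nPw : ~~ P w.
  apply/existsP=> -[u /andP[/eqP uw _]].
  by have := valP u; rewrite uw eqxx.
have Px : P (val x) by apply/existsP; exists x; rewrite eqxx connect0.
move=> /connect_exit/(_ Px nPw)[z [t [azt /existsP[u /andP[/eqP uz xu]] nPt]]].
rewrite -{}uz in azt.
have [tw|tw] := eqVneq t w.
  by exists u; rewrite // adj_sym -[X in adj _ X]tw.
case/existsP: nPt; exists (Sub t tw); rewrite eqxx.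
exact: connect_trans xu (connect1 _).
Qed.

Lemma geodesic_via_deleted_vertex x y p :
  adj w (val x) -> adj w (val y) -> ~~ connect (@adj H) x y ->
  geodesic (val x) (val y) p -> p = [:: w; val y].
Proof.
move=> wx wy nxy [pP pmin]; have [pp lp _] := pP.
have w_p : w \in p.
  by apply: contraR nxy => /(is_path_lift pP)[q /is_path_connect].
have xy : val x != val y by apply: contraNneq nxy => /val_inj->.
have : size p <= 2.
  apply: (pmin [:: w; val y]); split=> //=; first by rewrite adj_sym wx wy.
  by rewrite !inE negb_or xy (valP x) eq_sym (valP y).
case/splitPr: w_p lp {pP pmin pp} => p1 [|z [|? ?]];
  rewrite last_cat size_cat /=.
- by move=> wE; have := valP y; rewrite /= -wE eqxx.
- by move=> ->; case: p1 => //= ? ?; rewrite addnC.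
- by rewrite !addnS.
Qed.

Lemma components_del_vertex_le_num_colours c : connected G ->
  strongly_rainbow_connected c -> components H <= num_colours c.
Proof.
move=> connG cP.
have /fin_all_exists2[f wf xf] x := del_vertex_neighbour (connG (val x) w).
apply: (@num_colours_ge _ _ _ _ (fun x => [set w; val (f x)])) => [x _|x y].
  exact: adj_edge.
rewrite !inE !andbT => /eqP rx /eqP ry /= cxy; rewrite -rx -ry.
apply/(rootP (@adj_connect_sym H)); apply/idPn=> nxy.
have nf : ~~ connect (@adj H) (f x) (f y).
  apply: contra nxy => cf; apply: connect_trans (xf x) (connect_trans cf _).
  by rewrite adj_connect_sym.
have [p gp rp] := cP (val (f x)) (val (f y)).
move: rp; rewrite (geodesic_via_deleted_vertex (wf x) (wf y) nf gp).
by rewrite /rainbow /= inE setUC cxy eqxx.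
Qed.

Lemma pendent_notin_path x y p :
  degree w <= 1 -> is_path (val x) (val y) p -> w \notin p.
Proof.
move=> /card_le1_eqP deg_w [pp lp Up]; apply/negP=> /splitPr wp.
case: wp Up pp lp => p1 [|z p2];
  rewrite cat_path last_cat -cat_cons cat_uniq /=.
  by move=> _ _ wy; have := valP y; rewrite /= -wy eqxx.
case/and3P=> _ /norP[_ /norP[nz _]] _ /and4P[_ a1 a2 _] _.
have zE : z = last (val x) p1 by apply: deg_w; rewrite inE // adj_sym.
by case/negP: nz; rewrite zE mem_last.
Qed.

Lemma pendent_is_path_lift x y p : degree w <= 1 -> is_path (val x) (val y) p ->
  exists2 q, is_path x y q & p = map val q.
Proof.
by move=> deg_w pP; apply: is_path_lift (pendent_notin_path deg_w pP).
Qed.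

Lemma pendent_geodesic_lift x y p :
  degree w <= 1 -> geodesic (val x) (val y) p ->
  exists2 q, geodesic x y q & p = map val q.
Proof.
move=> deg_w [pP pmin]; have [q qP pE] := pendent_is_path_lift deg_w pP.
exists q => //; split=> // s /is_path_del_vertex/pmin.
by rewrite pE !size_map.
Qed.

Definition del_vertex_colouring c : colouring H :=
  fun e => c [set val z | z in e].

Lemma del_vertex_colouring_set2 c x y :
  del_vertex_colouring c [set x; y] = c [set val x; val y].
Proof. by rewrite /del_vertex_colouring imsetU1 imset_set1. Qed.

Lemma rainbow_del_vertex c x q :
  rainbow c (val x) (map val q) -> rainbow (del_vertex_colouring c) x q.
Proof.
rewrite /rainbow; congr (is_true (uniq _)).
by elim: q x => //= z q IHq x; rewrite IHq del_vertex_colouring_set2.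
Qed.

Lemma num_colours_del_vertex c :
  num_colours (del_vertex_colouring c) <= num_colours c.
Proof.
apply: uniq_leq_size => [|k]; first exact: undup_uniq.
rewrite !mem_undup => /imageP[e /edgesP[u [v [auv ->]]] ->].
by rewrite del_vertex_colouring_set2; apply/image_f/adj_edge.
Qed.

Lemma rainbow_connected_del_pendent c : degree w <= 1 ->
  rainbow_connected c -> rainbow_connected (del_vertex_colouring c).
Proof.
move=> deg_w cP x y.
have [p /(pendent_is_path_lift deg_w)[q qP ->]] := cP (val x) (val y).
by move/rainbow_del_vertex; exists q.
Qed.

Lemma strongly_rainbow_connected_del_pendent c : degree w <= 1 ->
  strongly_rainbow_connected c ->
  strongly_rainbow_connected (del_vertex_colouring c).
Proof.
move=> deg_w cP x y.
have [p /(pendent_geodesic_lift deg_w)[q qP ->]] := cP (val x) (val y).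
by move/rainbow_del_vertex; exists q.
Qed.

End DelVertex.

(** * The inequalities between the parameters *)

Section ConnectedGraph.

Variable G : sgraph.
Hypothesis connG : connected G.

Lemma strongly_rainbow_connected_exists :
  exists c : colouring G, strongly_rainbow_connected c.
Proof.
have [c cP _] := choosable_num_colours (strongly_rainbow_choosable_edges connG).
by exists c.
Qed.

Lemma src_attained :
  exists2 c : colouring G, strongly_rainbow_connected c & num_colours c = src G.
Proof. exact/colour_number_attained/strongly_rainbow_connected_exists. Qed.

Lemma rc_attained :
  exists2 c : colouring G, rainbow_connected c & num_colours c = rc G.
Proof.
apply: colour_number_attained; have [c cP] := strongly_rainbow_connected_exists.
by exists c; apply: strongly_rainbow_connectedW.
Qed.

Lemma diam_le_rc : diam G <= rc G.
Proof. by have [c cP <-] := rc_attained; apply: rainbow_connected_diam_le. Qed.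

Lemma bridges_le_rc : #|bridges G| <= rc G.
Proof.
by have [c cP <-] := rc_attained; apply: rainbow_connected_bridges_le.
Qed.

Lemma components_del_vertex_le_src (v : G) : components (del_vertex v) <= src G.
Proof.
by have [c cP <-] := src_attained; apply: components_del_vertex_le_num_colours.
Qed.

Lemma rc_le_src : rc G <= src G.
Proof.
have [c /strongly_rainbow_connectedW cP <-] := src_attained.
exact: colour_number_le.
Qed.

Lemma src_le_rc : rc G <= 2 -> src G <= rc G.
Proof.
have [c cP <-] := rc_attained => c2.
exact/colour_number_le/two_colours_strongly_rainbow_connected.
Qed.

Lemma rc_le_rcl : rc G <= rcl G.
Proof.
exact: colour_number_le_choice_number (rainbow_choosable_order connG).
Qed.

Lemma src_le_srcl : src G <= srcl G.
Proof.
exact: colour_number_le_choice_number (strongly_rainbow_choosable_edges connG).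
Qed.

Lemma rcl_le_order : rcl G <= #|G| - 1.
Proof. exact: choice_number_le (rainbow_choosable_order connG). Qed.

Lemma srcl_le_edges : srcl G <= #|edges G|.
Proof. exact: choice_number_le (strongly_rainbow_choosable_edges connG). Qed.

Lemma rcl_le_srcl : rcl G <= srcl G.
Proof.
apply/choice_number_le/(choosableW (@strongly_rainbow_connectedW G)).
exact: choosable_choice_number (strongly_rainbow_choosable_edges connG).
Qed.

Lemma diam_le1_srcl_le1 : diam G <= 1 -> srcl G <= 1.
Proof.
by move/(diam_le1_strongly_rainbow_choosable connG)/choice_number_le.
Qed.

Lemma tree_edges_le_rc : tree G -> #|edges G| <= rc G.
Proof.
move/(tree_bridgesP connG)/subset_leq_card=> le_bridges.
exact: leq_trans le_bridges bridges_le_rc.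
Qed.

Lemma edges_le_srcl_tree : #|edges G| <= srcl G -> tree G.
Proof.
move=> le_E; apply/(tree_bridgesP connG).
apply: contraLR le_E => /subsetPn[e eE neB].
have /choice_number_le := nonbridge_strongly_rainbow_choosable connG eE neB.
rewrite -ltnNge => le_pred; apply: (leq_ltn_trans le_pred).
by rewrite ltn_predL; apply/card_gt0P; exists e.
Qed.

Lemma rc_del_pendent (w : G) : degree w <= 1 -> rc (del_vertex w) <= rc G.
Proof.
move=> deg_w; apply: colour_number_transfer (num_colours_del_vertex w).
  by have [c cP _] := rc_attained; exists c.
by move=> c; apply: rainbow_connected_del_pendent.
Qed.

Lemma src_del_pendent (w : G) : degree w <= 1 -> src (del_vertex w) <= src G.
Proof.
move=> deg_w; apply: colour_number_transfer (num_colours_del_vertex w).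
  exact: strongly_rainbow_connected_exists.
by move=> c; apply: strongly_rainbow_connected_del_pendent.
Qed.

End ConnectedGraph.

Theorem theorem2p1 (G : sgraph) (nontrivialG : 1 < #|G|)
    (connG : connected G) :
  (* (a) *)
  ((diam G <= rc G /\ rc G <= rcl G /\ rcl G <= #|G| - 1) /\
   (diam G <= rc G /\ rc G <= src G /\ src G <= srcl G /\
    srcl G <= #|edges G|)) /\
  (* (b) *)
  (forall p : nat, #|bridges G| = p -> p <= rc G) /\
  (* (c) *)
  (forall (v : G) (q : nat), cut_vertex v ->
     components (del_vertex v) = q -> 2 <= q -> q <= src G) /\
  (* (d) *)
  (forall w : G, 3 <= #|G| -> pendent w ->
     rc (del_vertex w) <= rc G /\ src (del_vertex w) <= src G) /\
  (* (e) *)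
  [<-> complete G; diam G = 1; rc G = 1; src G = 1; rcl G = 1; srcl G = 1] /\
  (* (f) *)
  ((rc G = 2 <-> src G = 2) /\
   (srcl G = 2 -> rcl G = 2) /\
   (rcl G = 2 -> rc G = 2 /\ src G = 2)) /\
  (* (g) *)
  [<-> tree G; rc G = #|edges G|; src G = #|edges G|; rcl G = #|edges G|;
       srcl G = #|edges G|].
Proof.
have diam_gt0 := diam_gt0 connG nontrivialG; have diam_rc := diam_le_rc connG.
have rc_src := rc_le_src connG; have src_rc := src_le_rc connG.
have rc_rcl := rc_le_rcl connG; have rcl_srcl := rcl_le_srcl connG.
have src_srcl := src_le_srcl connG; have srcl_E := srcl_le_edges connG.
have diam_srcl := diam_le1_srcl_le1 connG.
have diamP := diam_le1_complete connG.
have tree_rc := tree_edges_le_rc connG.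
have srcl_tree := edges_le_srcl_tree connG.
have srcl_rc : #|edges G| <= srcl G -> #|edges G| <= rc G.
  by move/srcl_tree/tree_rc.
split; first by do !split=> //; apply: rcl_le_order.
split; first by move=> p <-; apply: bridges_le_rc.
split; first by move=> v q _ <- _; apply: components_del_vertex_le_src.
split.
  by move=> w _ deg_w; rewrite rc_del_pendent ?src_del_pendent ?deg_w.
split.
  by tfae; [move/diamP | .. | move=> srcl1; apply/diamP]; lia.
split; first by do ![split]; lia.
by tfae; [move/tree_rc | .. | move=> srclE; apply: srcl_tree]; lia.
Qed.
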